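(* Let $\mathbb V$ be a Schubert representation of $\widehat H_n$ with evaluation map $\operatorname{ev}$. For $\mu,\nu\subseteq(n-k)^k$, $\operatorname{ev}(\overline T_\mu\cdot\mathcal Y_\nu)=\operatorname{ev}(\mathcal Y_{\mathrm{id}})$ if $\mu=\nu$ and $=0$ otherwise. Moreover, for every $\mathbb F$-linear combination $f$ of the $\mathcal Y_\lambda$ ($\lambda\subseteq(n-k)^k$), $$f=\frac1{\operatorname{ev}(\mathcal Y_{\mathrm{id}})}\sum_{\lambda\subseteq(n-k)^k}\operatorname{ev}(\overline T_\lambda\cdot f)\,\mathcal Y_\lambda.$$
   Context: $\mathcal A_\hbar=\mathbb Q[p,q,\hbar]$; $\widehat H_n$ is generated over $\mathcal A_\hbar$ by $T_1,\dots,T_{n-1},x_1,\dots,x_n$ with relations $(T_i+p)(T_i-q)=0$, braid relations, $x_ix_j=x_jx_i$, $T_ix_j=x_jT_i$ ($j\ne i,i+1$), $T_ix_i=x_{i+1}T_i+(\hbar-(p-q)x_i)$, $T_ix_{i+1}=x_iT_i-(\hbar-(p-q)x_i)$; $T_w,\overline T_w$ via reduced words with $\overline T_i=T_i+p-q$. Schubert representation: field $\mathbb F$ with $t_1,\dots,t_n$, ring map $\mathcal A_\hbar\to\mathbb F$, $\mathbb F$-space $\mathbb V$ with $\widehat H_n$-action, basis $\mathcal Y_w=T_{w^{-1}w_0}\mathcal Y_{w_0}$, $\mathbb F$-linear $\operatorname{ev}$ with $\operatorname{ev}(\mathcal Y_w)\ne0\iff w=\mathrm{id}$ and $\operatorname{ev}(x_i\mathcal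 Y_w)=t_i\operatorname{ev}(\mathcal Y_w)$. For $\lambda\subseteq(n-k)^k$, $w_\lambda$ is the Grassmannian permutation with $w_\lambda(k+1-i)=\lambda_i+k+1-i$ ($1\le i\le k$), increasing on $\{k+1,\dots,n\}$. $[m]=(p^m-q^m)/(p-q)$, $[m]!=\prod_{j\le m}[j]$, $d=\binom k2+\binom{n-k}2$, $\Sigma^n_k=\frac1{[k]![n-k]!}\sum_{v\in S_k\times S_{n-k}}q^{d-\ell(v)}\overline T_v$, $\overline T_\lambda=\overline T_{w_\lambda}\Sigma^n_k$, $\mathcal Y_\lambda=\sum_{v\in S_k\times S_{n-k}}p^{\ell(v)}\mathcal Y_{w_\lambda v}$ (the quantities $[k]![n-k]!$ are assumed invertible in $\mathbb F$). *)

(* Defs.v *)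
From HB Require Import structures.
From mathcomp Require Import all_boot all_order all_algebra.
From mathcomp Require Import fingroup perm.
Set Implicit Arguments. Unset Strict Implicit. Unset Printing Implicit Defensive.
Import GRing.Theory.
Local Open Scope ring_scope.

(* ---------- Combinatorics of S_n ----------
   Conventions: the positions/values 1..n of the paper are the ordinals
   0..n-1 of 'I_n; the generator index i in 1..n-1 of the paper is the
   ordinal i-1 : 'I_n.-1.  Permutations are functions 'I_n -> 'I_n; the
   paper's product u v (composition of functions, u after v) is
   [pcomp u v] = (v * u)%g in MathComp (whose product is left-to-right). *)

Definition pcomp n (u v : 'S_n) : 'S_n := (v * u)%g.

Lemma sgen_lt_l n (i : 'I_n.-1) : (i < n)%N.
Proof. case: i => i /= Hi; apply: (leq_trans Hi); exact: leq_pred. Qed.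

Lemma sgen_lt_r n (i : 'I_n.-1) : (i.+1 < n)%N.
Proof. case: i => i /= Hi; case: n Hi => //. Qed.

Definition sposL n (i : 'I_n.-1) : 'I_n := Ordinal (sgen_lt_l i).
Definition sposR n (i : 'I_n.-1) : 'I_n := Ordinal (sgen_lt_r i).

Definition sgen n (i : 'I_n.-1) : 'S_n := tperm (sposL i) (sposR i).

Definition word_perm n (s : seq 'I_n.-1) : 'S_n :=
  foldr (fun i w => pcomp (sgen i) w) 1%g s.

Definition perm_length n (w : 'S_n) : nat :=
  #|[set ab : 'I_n * 'I_n | (ab.1 < ab.2)%N && (w ab.2 < w ab.1)%N]|.

Definition w0 n : 'S_n := perm (@rev_ord_inj n).

Definition young n k : {set 'S_n} :=
  [set v : 'S_n | [forall a : 'I_n, (a < k)%N == (v a < k)%N]].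

Definition apply_word n (V : Type) (A : 'I_n.-1 -> V -> V) (s : seq 'I_n.-1)
  (v : V) : V := foldr (fun i u => A i u) v s.

(* A_w := A_{i_1} ... A_{i_l} for some reduced word w = s_{i_1} ... s_{i_l}
   (a word of length l(w) whose product is w).  By the braid relations
   (Matsumoto's theorem) this does not depend on the chosen reduced word. *)
Definition op_perm n (V : Type) (A : 'I_n.-1 -> V -> V) (w : 'S_n) (v : V) : V :=
  match [pick s : (perm_length w).-tuple 'I_n.-1 | word_perm s == w] with
  | Some s => apply_word A s v
  | None => v
  end.

(* lam i (i : 'I_k) is the part lambda_{i+1}; parts lie in 0..n-k *)
Definition in_box n k (lam : {ffun 'I_k -> 'I_(n - k).+1}) : bool :=
  [forall i : 'I_k, forall j : 'I_k, (i <= j)%N ==> (lam j <= lam i)%N].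

(* w is the Grassmannian permutation w_lambda:
   w(k+1-i) = lambda_i + k+1-i for 1 <= i <= k, and w increasing on
   {k+1,...,n} (written in 0-based positions/values) *)
Definition is_wlam n k (lam : {ffun 'I_k -> 'I_(n - k).+1}) (w : 'S_n) : bool :=
  [forall i : 'I_k, forall a : 'I_n,
     (val a == k - 1 - i)%N ==> (val (w a) == lam i + (k - 1 - i))%N]
  && [forall a : 'I_n, forall b : 'I_n,
     ((k <= a)%N && (a < b)%N) ==> (w a < w b)%N].

Definition wlam n k (lam : {ffun 'I_k -> 'I_(n - k).+1}) : 'S_n :=
  odflt 1%g [pick w : 'S_n | is_wlam lam w].

Section QNum.
Variable F : comPzRingType.
Variables p q : F.

(* [m] = (p^m - q^m)/(p - q) = sum_{j<m} p^j q^(m-1-j) *)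
Definition qint (m : nat) : F := \sum_(j < m) p ^+ j * q ^+ (m - 1 - j).
Definition qfact (m : nat) : F := \prod_(1 <= j < m.+1) qint j.
End QNum.

Section Hecke.
Variable F : fieldType.
Variable V : lmodType F.
Variable n : nat.
Variables p q hb : F.                       (* images of p, q, hbar in F *)
Variable T : 'I_n.-1 -> {linear V -> V}.
Variable x : 'I_n -> {linear V -> V}.

Definition affine_hecke_relations : Prop :=
     (forall i v, T i (T i v - q *: v) + p *: (T i v - q *: v) = 0) /\
      (forall (i j : 'I_n.-1) v, val j = (val i).+1 ->
          T i (T j (T i v)) = T j (T i (T j v))) /\
      (forall (i j : 'I_n.-1) v, (i.+1 < j)%N -> T i (T j v) = T j (T i v)) /\
      (forall a b v, x a (x b v) = x b (x a v)) /\
      (forall i a v, a != sposL i -> a != sposR i -> T i (x a v) = x a (T i v)) /\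
      (forall i v, T i (x (sposL i) v)
                   = x (sposR i) (T i v) + (hb *: v - (p - q) *: x (sposL i) v)) /\
      (forall i v, T i (x (sposR i) v)
                   = x (sposL i) (T i v) - (hb *: v - (p - q) *: x (sposL i) v)).

Definition Tbar (i : 'I_n.-1) (v : V) : V := T i v + (p - q) *: v.

Definition Top (w : 'S_n) : V -> V := op_perm (fun i => T i) w.
Definition Tbarop (w : 'S_n) : V -> V := op_perm Tbar w.

Definition Ybas (Yw0 : V) (w : 'S_n) : V := Top (pcomp w^-1 (w0 n)) Yw0.

Variable k : nat.

Definition dlen : nat := 'C(k, 2) + 'C(n - k, 2).

Definition Sigma (v : V) : V :=
  (qfact p q k * qfact p q (n - k))^-1 *:
    \sum_(u in young n k) q ^+ (dlen - perm_length u) *: Tbarop u v.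

Definition Tbarlam (lam : {ffun 'I_k -> 'I_(n - k).+1}) (v : V) : V :=
  Tbarop (wlam lam) (Sigma v).

Definition Ylam (Yw0 : V) (lam : {ffun 'I_k -> 'I_(n - k).+1}) : V :=
  \sum_(u in young n k) p ^+ perm_length u *: Ybas Yw0 (pcomp (wlam lam) u).

End Hecke.

(* Main.v *)
(* With s_i acting on the right, T_i Y_w = Y_{w s_i} if w s_i < w, and
   Tbar_i Y_w = p q Y_{w s_i} if w s_i > w; this rests on T_w not depending on
   the reduced word.  Induction on l(u), peeling off the last letter of a reduced
   word, gives ev(Tbar_u Y_w) = delta_{u,w} ev(Y_id).  On Y_lambda every Tbar_i
   with s_i in S_k x S_{n-k} acts by p, so Sigma acts by the Poincare polynomial
   of S_k x S_{n-k} divided by [k]![n-k]!, that is, by 1.  Hence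
   ev(Tbar_mu Y_nu) = sum_v p^l(v) ev(Tbar_{w_mu} Y_{w_nu v}), and w_mu = w_nu v
   forces mu = nu and v = id.  The expansion formula follows by linearity. *)
Require Import Defs.
From HB Require Import structures.
From mathcomp Require Import all_boot all_order all_algebra.
From mathcomp Require Import fingroup perm.
From mathcomp Require Import zify ring.
Set Implicit Arguments. Unset Strict Implicit. Unset Printing Implicit Defensive.
Import GRing.Theory.
Local Open Scope ring_scope.

(* [ssrfun.pcomp] would otherwise take precedence. *)
Local Notation pcomp := Defs.pcomp.

(** * Inversions, descents and the length function on $S_n$ *)

Lemma pcompE n (u v : 'S_n) a : pcomp u v a = u (v a).
Proof. by rewrite /pcomp permM. Qed.

Lemma sgenP n (i : 'I_n.-1) a :
  nat_of_ord (sgen i a) =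
    (if a == i :> nat then i.+1 else if a == i.+1 :> nat then nat_of_ord i else a)%N.
Proof.
rewrite /sgen; case: tpermP => [->|->|/eqP + /eqP] /=.
- by rewrite eqxx.
- by rewrite eqn_leq ltnn eqxx.
by rewrite -!val_eqE /= => /negPf -> /negPf ->.
Qed.

Lemma sgenL n (i : 'I_n.-1) : sgen i (sposL i) = sposR i.
Proof. exact: tpermL. Qed.

Lemma sgenR n (i : 'I_n.-1) : sgen i (sposR i) = sposL i.
Proof. exact: tpermR. Qed.

Lemma sgenK n (i : 'I_n.-1) (a : 'I_n) : sgen i (sgen i a) = a.
Proof. exact: tpermK. Qed.

Lemma pcomp_sgenlK n (i : 'I_n.-1) (w : 'S_n) :
  pcomp (sgen i) (pcomp (sgen i) w) = w.
Proof. by apply/permP => a; rewrite !pcompE sgenK. Qed.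

Lemma pcomp_sgenrK n (i : 'I_n.-1) (w : 'S_n) :
  pcomp (pcomp w (sgen i)) (sgen i) = w.
Proof. by apply/permP => a; rewrite !pcompE sgenK. Qed.

Lemma pcompA n (u v w : 'S_n) : pcomp u (pcomp v w) = pcomp (pcomp u v) w.
Proof. by rewrite /pcomp mulgA. Qed.

Lemma pcompV n (u v : 'S_n) : (pcomp u v)^-1%g = pcomp v^-1 u^-1.
Proof. by rewrite /pcomp invMg. Qed.

Lemma sgenV n (i : 'I_n.-1) : ((sgen i)^-1 = sgen i)%g.
Proof. exact: tpermV. Qed.

Lemma pcomp_sgenlV n (i : 'I_n.-1) (w : 'S_n) a :
  (pcomp (sgen i) w)^-1%g a = w^-1%g (sgen i a).
Proof. by rewrite pcompV sgenV pcompE. Qed.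

(** The bijection $(a,b)\mapsto(w(b),w(a))$ carries the inversions of $w$ to those of $w^{-1}$. *)
Lemma perm_lengthV n (w : 'S_n) : perm_length w^-1 = perm_length w.
Proof.
rewrite /perm_length -(card_imset (mem [set ab : 'I_n * 'I_n | (ab.1 < ab.2)%N && (w ab.2 < w ab.1)%N])
  (f := fun ab => (w ab.2, w ab.1))); last first.
  by move=> [a b] [c d] /= [/perm_inj -> /perm_inj ->].
apply: eq_card => -[a b]; rewrite !inE /=; apply/idP/imsetP => [/andP[ab wab]|].
  by exists (w^-1 b, w^-1 a)%g; rewrite ?inE /= ?permKV ?ab ?wab.
by case=> -[c d]; rewrite inE /= => /andP[cd wcd] [-> ->]; rewrite !permK cd wcd.
Qed.

(** Applying $s_i$ to both entries of a pair carries the inversions of $w$ to those of $ws_i$, all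
    but the new one [(sposL i, sposR i)]. *)
Lemma perm_length_sgenr n (w : 'S_n) (i : 'I_n.-1) :
  (w (sposL i) < w (sposR i))%N ->
  perm_length (pcomp w (sgen i)) = (perm_length w).+1.
Proof.
move=> asc; pose f (ab : 'I_n * 'I_n) := (sgen i ab.1, sgen i ab.2).
have f_inj : injective f.
  by move=> [a b] [c d] [/perm_inj -> /perm_inj ->].
rewrite /perm_length.
set I := [set ab : 'I_n * 'I_n | (ab.1 < ab.2)%N && (w ab.2 < w ab.1)%N].
rewrite -[in RHS](card_imset (mem I) f_inj).
have LRI : (sposL i, sposR i) \notin [set f ab | ab in I].
  apply/imsetP => -[[a b]]; rewrite inE /= => /andP[ab wab] [ea eb].
  have := sgenK i a; have := sgenK i b; rewrite -ea -eb sgenL sgenR.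
  by move=> eb' ea'; move: ab; rewrite -eb' -ea' /= ltnNge leqnSn.
rewrite -[RHS]add1n -[(1 + _)%N]/(true + _)%N -LRI -cardsU1.
apply: eq_card => -[a b]; rewrite !inE /= !pcompE xpair_eqE.
have fab : ((a, b) \in [set f ab | ab in I]) = (f (a, b) \in I).
  rewrite -[X in X \in _ = _](_ : f (f (a, b)) = _); last by rewrite /f /= !sgenK.
  by rewrite mem_imset.
rewrite fab inE /=.
case: (boolP ((a == sposL i) && (b == sposR i))) => [/andP[/eqP-> /eqP->]|].
  by rewrite /= sgenL sgenR asc ltnSn.
move=> ne; case wab: (w (sgen i b) < w (sgen i a))%N; rewrite ?andbF ?andbT //=.
have ne' : ~~ ((a == sposR i) && (b == sposL i)).
  apply/negP => /andP[/eqP ea /eqP eb]; move: wab; rewrite ea eb sgenL sgenR.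
  by rewrite ltnNge (ltnW asc).
move: ne ne'; rewrite -!val_eqE /= !sgenP /=.
by do !case: eqP => /=; lia.
Qed.

Lemma perm_length_sgenl n (w : 'S_n) (i : 'I_n.-1) :
  (w^-1%g (sposL i) < w^-1%g (sposR i))%N ->
  perm_length (pcomp (sgen i) w) = (perm_length w).+1.
Proof.
by move=> asc; rewrite -perm_lengthV pcompV sgenV perm_length_sgenr ?perm_lengthV.
Qed.

Lemma sgen_asc_desc n (w : 'S_n) (i : 'I_n.-1) :
  (w (sposL i) < w (sposR i))%N = ~~ (w (sposR i) < w (sposL i))%N.
Proof.
rewrite -leqNgt [RHS]leq_eqVlt; case: eqP => // /val_inj /perm_inj.
by move=> /(congr1 val) /=; lia.
Qed.

Lemma perm_length_sgenr_desc n (w : 'S_n) (i : 'I_n.-1) :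
  (w (sposR i) < w (sposL i))%N ->
  perm_length w = (perm_length (pcomp w (sgen i))).+1.
Proof.
move=> desc; rewrite -[in LHS](pcomp_sgenrK i w) perm_length_sgenr //.
by rewrite !pcompE sgenL sgenR.
Qed.

Lemma perm_length_sgenl_desc n (w : 'S_n) (i : 'I_n.-1) :
  (w^-1%g (sposR i) < w^-1%g (sposL i))%N ->
  perm_length w = (perm_length (pcomp (sgen i) w)).+1.
Proof.
move=> desc; rewrite -[in LHS](pcomp_sgenlK i w) perm_length_sgenl //.
by rewrite !pcomp_sgenlV sgenL sgenR.
Qed.

(** Both $w$ and $w^{-1}$ are increasing, and an increasing $u$ satisfies $a\le u(a)$. Applied to
    $w$ at $a$ and to $w^{-1}$ at $w(a)$, this forces $w(a)=a$. *)
Lemma perm_no_descent n (w : 'S_n) :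
  (forall i, (w (sposL i) < w (sposR i))%N) -> w = 1%g.
Proof.
move=> asc.
have mono : forall d (a b : 'I_n), (nat_of_ord b = a + d.+1)%N -> (w a < w b)%N.
  elim=> [|d IHd] a b ab; have ltb := ltn_ord b.
    have lta : (a < n.-1)%N by move: ab ltb; lia.
    have := asc (Ordinal lta).
    have -> : sposL (Ordinal lta) = a by apply: val_inj.
    by have -> : sposR (Ordinal lta) = b by apply: val_inj; rewrite /= ab addn1.
  have ltc : (a + d.+1 < n)%N by move: ab ltb; lia.
  have lta : (a + d.+1 < n.-1)%N by move: ab ltb; lia.
  apply: (ltn_trans (IHd a (Ordinal ltc) erefl)).
  have := asc (Ordinal lta).
  have -> : sposL (Ordinal lta) = Ordinal ltc by apply: val_inj.
  by have -> : sposR (Ordinal lta) = b by apply: val_inj; rewrite /= ab; lia.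
have inc (a b : 'I_n) : (a < b)%N -> (w a < w b)%N.
  by move=> ab; apply: (mono (b - a).-1); lia.
have incV (a b : 'I_n) : (a < b)%N -> (w^-1%g a < w^-1%g b)%N.
  move=> ab; rewrite ltnNge; apply/negP; rewrite leq_eqVlt => /orP[/eqP/val_inj/perm_inj ba|/inc].
    by move: ab; rewrite ba ltnn.
  by rewrite !permKV ltnNge (ltnW ab).
have ge (u : 'S_n) : (forall a b : 'I_n, (a < b)%N -> (u a < u b)%N) ->
    forall m (a : 'I_n), nat_of_ord a = m -> (m <= u a)%N.
  move=> incu; elim=> // m IHm a am; have ltm : (m < n)%N by have := ltn_ord a; lia.
  by apply: (leq_ltn_trans (IHm (Ordinal ltm) erefl)); apply: incu; rewrite /= am.
apply/permP => a; rewrite perm1; apply: val_inj; apply/eqP; rewrite eqn_leq.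
rewrite (ge w inc _ a erefl) andbT.
by have := ge _ incV _ (w a) erefl; rewrite permK.
Qed.

Lemma perm_length1 n : perm_length (1%g : 'S_n) = 0%N.
Proof.
apply/eqP; rewrite cards_eq0; apply/eqP/setP => -[a b]; rewrite !inE !perm1 /=.
by apply/negP => /andP[/ltnW]; rewrite leqNgt => /negP.
Qed.

(** * Reduced words *)

Definition reduced n (s : seq 'I_n.-1) := perm_length (word_perm s) == size s.

Lemma perm_length_word n (s : seq 'I_n.-1) :
  (perm_length (word_perm s) <= size s)%N.
Proof.
elim: s => [|i s IHs] /=; first by rewrite perm_length1.
set w := word_perm s in IHs *.
case: (boolP (w^-1%g (sposL i) < w^-1%g (sposR i))%N) => [asc|].
  by rewrite perm_length_sgenl.
rewrite sgen_asc_desc negbK => /perm_length_sgenl_desc; rewrite -/w; lia.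
Qed.

(** If $s_i$ shortened the permutation of the tail, that permutation would have length [size s + 2],
    more than the tail has letters. *)
Lemma reduced_cons n i (s : seq 'I_n.-1) :
  reduced (i :: s) ->
  reduced s /\ ((word_perm s)^-1%g (sposL i) < (word_perm s)^-1%g (sposR i))%N.
Proof.
rewrite /reduced /=; have := perm_length_word s.
set w := word_perm s => les.
case: (boolP (w^-1%g (sposL i) < w^-1%g (sposR i))%N) => [asc|].
  by rewrite perm_length_sgenl // eqSS.
rewrite sgen_asc_desc negbK => /perm_length_sgenl_desc; rewrite -/w; lia.
Qed.

Lemma word_perm_rcons n (s : seq 'I_n.-1) i :
  word_perm (rcons s i) = pcomp (word_perm s) (sgen i).
Proof.
elim: s => [|j s IHs] /=; first by rewrite /pcomp mulg1 mul1g.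
by rewrite IHs pcompA.
Qed.

Lemma reduced_rcons n i (s : seq 'I_n.-1) :
  reduced (rcons s i) ->
  reduced s /\ (word_perm s (sposL i) < word_perm s (sposR i))%N.
Proof.
rewrite /reduced word_perm_rcons size_rcons; have := perm_length_word s.
set w := word_perm s => les.
case: (boolP (w (sposL i) < w (sposR i))%N) => [asc|].
  by rewrite perm_length_sgenr // eqSS.
rewrite sgen_asc_desc negbK => /perm_length_sgenr_desc; rewrite -/w; lia.
Qed.

(** Strip left descents one by one; the process stops only at the identity, by [perm_no_descent]. *)
Lemma reduced_word_exists n (w : 'S_n) :
  exists2 s, reduced s & word_perm s = w.
Proof.
move: {2}(perm_length w) (erefl (perm_length w)) => m; elim: m w => [|m IHm] w lw.
  exists [::]; first by rewrite /reduced /= perm_length1.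
  apply/esym; apply: perm_no_descent => i; rewrite sgen_asc_desc.
  by apply/negP => /perm_length_sgenr_desc; rewrite lw.
case: (pickP (fun i : 'I_n.-1 => w^-1%g (sposR i) < w^-1%g (sposL i))%N) => [i desc|asc].
  have lw' := perm_length_sgenl_desc desc.
  have [|s rs ws] := IHm (pcomp (sgen i) w); first by move: lw'; rewrite lw => -[].
  exists (i :: s); last by rewrite /= ws pcomp_sgenlK.
  rewrite /reduced /= ws pcomp_sgenlK lw'.
  by move: rs; rewrite /reduced ws => /eqP ->.
have w1 : w^-1%g = 1%g by apply: perm_no_descent => i; rewrite sgen_asc_desc asc.
by move: lw; rewrite -perm_lengthV w1 perm_length1.
Qed.

(** Existence of reduced words excludes the default branch of [op_perm]. *)
Lemma op_permP n (V : Type) (A : 'I_n.-1 -> V -> V) (w : 'S_n) :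
  exists s, [/\ reduced s, word_perm s = w &
                forall v, op_perm A w v = apply_word A s v].
Proof.
rewrite /op_perm; case: pickP => [s /eqP ws|none].
  by exists s; split; rewrite // /reduced ws size_tuple.
have [s /eqP rs ws] := reduced_word_exists w.
have sz : size s == perm_length w by rewrite -rs ws.
by have /eqP := none (Tuple sz).
Qed.

(** * Independence of the chosen reduced word *)

Section Matsumoto.
Variables (n : nat) (V : Type) (A : 'I_n.-1 -> V -> V).
Hypothesis braid : forall (i j : 'I_n.-1) v, val j = (val i).+1 ->
  A i (A j (A i v)) = A j (A i (A j v)).
Hypothesis comm : forall (i j : 'I_n.-1) v, (i.+1 < j)%N ->
  A i (A j v) = A j (A i v).

(* Matsumoto's theorem: two distinct left descents i, j of w allow one to
   factor the longest element of the dihedral group generated by s_i and s_j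
   off w, so that induction applies to both tails. *)
Lemma apply_word_reduced (s t : seq 'I_n.-1) v :
  reduced s -> reduced t -> word_perm s = word_perm t ->
  apply_word A s v = apply_word A t v.
Proof.
move: {2}(size s) (erefl (size s)) => m.
elim: m s t => [|m IHm] s t szs rs rt est.
  have : size t = 0%N by rewrite -(eqP rt) -est (eqP rs).
  by move/size0nil=> ->; rewrite (size0nil szs).
have szt : size t = m.+1 by rewrite -(eqP rt) -est (eqP rs).
case: s szs rs est => // i s [szs] ris est; case: t szt rt est => // j t [szt] rjt est.
(* The claim is symmetric in the two words, while [braid] and [comm] are stated for $i<j$. *)
wlog leij : i j s t szs szt ris rjt est / (i <= j)%N.
  by move=> th; case: (leqP i j) => [|/ltnW] leij; [|apply/esym]; apply: th.
have [rs _] := reduced_cons ris; have [rt _] := reduced_cons rjt.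
move: leij; rewrite leq_eqVlt => /orP[/eqP/val_inj ij|ltij].
  rewrite /= (IHm s t) //; last first.
    move: est => /=; rewrite ij.
    by move=> /(congr1 (pcomp (sgen j))); rewrite !pcomp_sgenlK.
  by rewrite ij.
move: est; set w := word_perm (j :: t) => est.
have ws : word_perm s = pcomp (sgen i) w by rewrite -est /= pcomp_sgenlK.
have wt : word_perm t = pcomp (sgen j) w by rewrite /w /= pcomp_sgenlK.
have lw : perm_length w = m.+1 by rewrite (eqP rjt) /= szt.
clearbody w; have [_] := reduced_cons ris; have [_] := reduced_cons rjt.
rewrite ws wt !pcomp_sgenlV !sgenL !sgenR => descj desci.
have li := perm_length_sgenl_desc desci.
have lj := perm_length_sgenl_desc descj.
have [ij|nij] := eqVneq (nat_of_ord j) i.+1.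
  have jL : sposL j = sposR i by apply: val_inj.
  have iR : sgen i (sposR j) = sposR j.
    by apply: val_inj; rewrite [LHS]sgenP /= ij; do !case: eqP => //; lia.
  have jiL : sgen j (sposL i) = sposL i.
    by apply: val_inj; rewrite [LHS]sgenP /= ij; do !case: eqP => //; lia.
  (* For $j=i+1$, stripping $s_i$, $s_j$, $s_i$ in turn from $w$ lowers the length each time. With
     [r] spelling the rest, [j :: i :: r] and [i :: j :: r] are reduced words for the two tails. *)
  set w1 := pcomp (sgen i) w in li; set w2 := pcomp (sgen j) w1.
  have d2 : (w1^-1%g (sposR j) < w1^-1%g (sposL j))%N.
    by rewrite !pcomp_sgenlV jL iR sgenR; apply: ltn_trans desci; rewrite -jL.
  have l2 := perm_length_sgenl_desc d2.
  have d3 : (w2^-1%g (sposR i) < w2^-1%g (sposL i))%N.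
    by rewrite !pcomp_sgenlV jiL sgenL -jL sgenL iR.
  have l3 := perm_length_sgenl_desc d3.
  have [r rr wr] := reduced_word_exists (pcomp (sgen i) w2).
  have szr : size r = m.-2 by rewrite -(eqP rr) wr; move: l3 l2 li; rewrite -/w1 -/w2; lia.
  have m2 : (1 < m)%N by move: l3 l2 li; rewrite -/w1 -/w2 lw; lia.
  have brd : pcomp (sgen j) w = pcomp (sgen i) (pcomp (sgen j) (pcomp (sgen i) w2)).
    rewrite /w2 /w1; apply/permP => a; rewrite !pcompE; move: (w a) => b.
    apply: val_inj => /=; rewrite !sgenP /= ij; do ?case: eqP => //=; lia.
  have e1 : apply_word A s v = apply_word A (j :: i :: r) v.
    apply: IHm => //; rewrite ?/reduced /= wr ?ws //.
      by rewrite pcomp_sgenlK pcomp_sgenlK szr -/w1; move: lw li; rewrite -/w1; lia.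
    by rewrite pcomp_sgenlK pcomp_sgenlK.
  have e2 : apply_word A t v = apply_word A (i :: j :: r) v.
    apply: IHm => //; rewrite ?/reduced /= wr ?wt //.
    by rewrite -brd szr; move: lw lj; lia.
  by rewrite /= e1 e2 /= braid.
have lt2 : (i.+1 < j)%N by lia.
have iL : sgen i (sposL j) = sposL j.
  by apply: val_inj; rewrite [LHS]sgenP /=; do !case: eqP => //; lia.
have iR : sgen i (sposR j) = sposR j.
  by apply: val_inj; rewrite [LHS]sgenP /=; do !case: eqP => //; lia.
set w1 := pcomp (sgen i) w in li.
have d2 : (w1^-1%g (sposR j) < w1^-1%g (sposL j))%N by rewrite !pcomp_sgenlV iL iR.
have l2 := perm_length_sgenl_desc d2.
have [r rr wr] := reduced_word_exists (pcomp (sgen j) w1).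
have szr : size r = m.-1 by rewrite -(eqP rr) wr; move: l2 li; rewrite -/w1; lia.
have m1 : (0 < m)%N by move: l2 li; rewrite -/w1 lw; lia.
have cij : pcomp (sgen j) w = pcomp (sgen i) (pcomp (sgen j) w1).
  rewrite /w1; apply/permP => a; rewrite !pcompE; move: (w a) => b.
  apply: val_inj => /=; rewrite !sgenP /=; do ?case: eqP => //=; lia.
have e1 : apply_word A s v = apply_word A (j :: r) v.
  apply: IHm => //; rewrite ?/reduced /= wr ?ws //.
    by rewrite pcomp_sgenlK szr; move: lw li; rewrite -/w1; lia.
  by rewrite pcomp_sgenlK.
have e2 : apply_word A t v = apply_word A (i :: r) v.
  apply: IHm => //; rewrite ?/reduced /= wr ?wt //.
  by rewrite -cij szr; move: lw lj; lia.
by rewrite /= e1 e2 /= comm.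
Qed.

(** Prefixing [i] to the word chosen for $w$ gives a reduced word of $s_iw$, possibly not the one
    chosen there. *)
Lemma op_perm_sgenl (w : 'S_n) i v :
  (w^-1%g (sposL i) < w^-1%g (sposR i))%N ->
  op_perm A (pcomp (sgen i) w) v = A i (op_perm A w v).
Proof.
move=> asc; have [s [rs ws ->]] := op_permP A w.
have [t [rt wt ->]] := op_permP A (pcomp (sgen i) w).
rewrite -[A i _]/(apply_word A (i :: s) v); apply: apply_word_reduced => //.
  by rewrite /reduced /= ws perm_length_sgenl // -(eqP rs) ws.
by rewrite /= ws.
Qed.
End Matsumoto.

(** * The Young subgroup $S_k\times S_{n-k}$ *)

Lemma youngP n k (w : 'S_n) :
  reflect (forall a : 'I_n, (w a < k)%N = (a < k)%N) (w \in young n k).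
Proof.
rewrite inE; apply: (iffP forallP) => [yw a|yw a]; first by rewrite (eqP (yw a)).
by rewrite yw.
Qed.

(** In 0-based indexing $s_i$ swaps $i$ and $i+1$, so it straddles the two blocks exactly when
    $i+1=k$. *)
Lemma young_sgenr n k (w : 'S_n) (i : 'I_n.-1) :
  i.+1 != k -> (pcomp w (sgen i) \in young n k) = (w \in young n k).
Proof.
move=> ik; have h (u : 'S_n) : u \in young n k -> pcomp u (sgen i) \in young n k.
  move=> /youngP yu; apply/youngP => a; rewrite pcompE yu sgenP.
  by do !case: eqP => //; move: ik; lia.
by apply/idP/idP => [/h|/h //]; rewrite pcomp_sgenrK.
Qed.

Lemma young_sgenl n k (w : 'S_n) (i : 'I_n.-1) :
  i.+1 != k -> (pcomp (sgen i) w \in young n k) = (w \in young n k).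
Proof.
move=> ik; have h (u : 'S_n) : u \in young n k -> pcomp (sgen i) u \in young n k.
  move=> /youngP yu; apply/youngP => a; rewrite pcompE -(yu a) sgenP.
  by do !case: eqP => //; move: ik; lia.
by apply/idP/idP => [/h|/h //]; rewrite pcomp_sgenlK.
Qed.

Lemma youngV n k (w : 'S_n) : w \in young n k -> w^-1%g \in young n k.
Proof. by move=> /youngP yw; apply/youngP => a; rewrite -[in RHS](permKV w a) yw. Qed.

(** The equality of booleans puts $a$ and $b$ in the same block. Such $w$ are the minimal-length
    representatives of the cosets $w(S_k\times S_{n-k})$. *)
Definition block_increasing n k (w : 'S_n) :=
  forall a b : 'I_n, (a < k)%N = (b < k)%N -> (a < b)%N -> (w a < w b)%N.

(** * Action of $T_i$ and $\overline T_i$ on the basis $\mathcal Y_w$, and its evaluation *)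

Section HeckeAction.
Variables (F : fieldType) (V : lmodType F) (n : nat) (p q : F).
Variable T : 'I_n.-1 -> {linear V -> V}.

Lemma Tbar_is_linear i : linear (Tbar p q T i).
Proof.
move=> a u v; rewrite /Tbar linearP !scalerDr !scalerA [_ * a]mulrC.
by rewrite addrACA.
Qed.

Lemma Tbarop_is_linear w : linear (Tbarop p q T w).
Proof.
move=> a u v; rewrite /Tbarop; have [s [_ _ E]] := op_permP (Tbar p q T) w.
by rewrite !E; elim: s {E} => //= i s ->; rewrite Tbar_is_linear.
Qed.

HB.instance Definition _ i :=
  GRing.isLinear.Build F V V *:%R (Tbar p q T i) (Tbar_is_linear i).
HB.instance Definition _ w :=
  GRing.isLinear.Build F V V *:%R (Tbarop p q T w) (Tbarop_is_linear w).

Lemma Sigma_is_linear k : linear (Sigma p q T k).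
Proof.
move=> a u v; rewrite /Sigma [a *: (_ *: _)]scalerA [a * _]mulrC -scalerA -scalerDr; congr (_ *: _).
rewrite scaler_sumr -big_split; apply: eq_bigr => w _ /=.
by rewrite linearP scalerDr !scalerA [a * _]mulrC.
Qed.

HB.instance Definition _ k :=
  GRing.isLinear.Build F V V *:%R (Sigma p q T k) (Sigma_is_linear k).

Lemma Tbarlam_is_linear k (lam : {ffun 'I_k -> 'I_(n - k).+1}) :
  linear (Tbarlam p q T lam).
Proof. by move=> a u v; rewrite /Tbarlam !linearP. Qed.

HB.instance Definition _ k (lam : {ffun 'I_k -> 'I_(n - k).+1}) :=
  GRing.isLinear.Build F V V *:%R (Tbarlam p q T lam) (Tbarlam_is_linear lam).

Hypothesis quad : forall i v,
  T i (T i v - q *: v) + p *: (T i v - q *: v) = 0.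
Hypothesis braid : forall (i j : 'I_n.-1) v, val j = (val i).+1 ->
  T i (T j (T i v)) = T j (T i (T j v)).
Hypothesis comm : forall (i j : 'I_n.-1) v, (i.+1 < j)%N ->
  T i (T j v) = T j (T i v).
Variable Yw0 : V.
Notation Y := (Ybas T Yw0).

(** One has $(ws_i)^{-1}w_0=s_i\,(w^{-1}w_0)$. As $w_0$ reverses the order, a descent of $w$ at $i$
    makes this left multiplication increase the length. *)
Lemma T_Ybas_desc i (w : 'S_n) :
  (w (sposR i) < w (sposL i))%N -> T i (Y w) = Y (pcomp w (sgen i)).
Proof.
move=> desc; rewrite /Ybas /Top pcompV sgenV -pcompA.
rewrite (@op_perm_sgenl n V (fun i => T i)) //.
rewrite pcompV invgK !pcompE.
set a := w _; set b := w _; rewrite -/a -/b in desc.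
have w0E c : nat_of_ord ((w0 n)^-1%g c) = (n - c.+1)%N.
  have := ltn_ord ((w0 n)^-1%g c); rewrite -[in RHS](permKV (w0 n) c).
  by move: ((w0 n)^-1%g c) => d; rewrite permE /=; lia.
by rewrite !w0E; have := ltn_ord a; have := ltn_ord b; move: desc; lia.
Qed.

Lemma Tbar_Ybas_desc i (w : 'S_n) :
  (w (sposR i) < w (sposL i))%N ->
  Tbar p q T i (Y w) = Y (pcomp w (sgen i)) + (p - q) *: Y w.
Proof. by move=> desc; rewrite /Tbar T_Ybas_desc. Qed.

(** This is the quadratic relation, expanded as $T_i^2+(p-q)T_i=pq$. *)
Lemma Tbar_T i v : Tbar p q T i (T i v) = (p * q) *: v.
Proof.
apply/eqP; rewrite -subr_eq0 -(quad i v) [T i (_ - _)]linearB [T i (q *: _)]linearZ.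
by rewrite /= [p *: (_ - _)]scalerBr scalerA /Tbar scalerBl -!addrA [p *: _ + (- _ - _)]addrCA.
Qed.

(** Here $ws_i$ has a descent at $i$, so $\mathcal Y_w=T_i\mathcal Y_{ws_i}$ and [Tbar_T]
    applies. *)
Lemma Tbar_Ybas_asc i (w : 'S_n) :
  (w (sposL i) < w (sposR i))%N ->
  Tbar p q T i (Y w) = (p * q) *: Y (pcomp w (sgen i)).
Proof.
move=> asc; rewrite -[in LHS](pcomp_sgenrK i w) -T_Ybas_desc ?Tbar_T //.
by rewrite !pcompE sgenL sgenR.
Qed.

(* For u < u s_i the sum contains p^l(u) (Y_(wu) + p Y_(wus_i)), and each such
   pair is an eigenvector of Tbar_i for the eigenvalue p. *)
Lemma Tbar_block_sum k (w : 'S_n) (i : 'I_n.-1) :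
  block_increasing k w -> i.+1 != k ->
  let y := \sum_(u in young n k) p ^+ perm_length u *: Y (pcomp w u) in
  Tbar p q T i y = p *: y.
Proof.
move=> incw ik /=; set desc := fun u : 'S_n => (u (sposR i) < u (sposL i))%N.
have s_inj : injective (fun u : 'S_n => pcomp u (sgen i)).
  exact: can_inj (pcomp_sgenrK i).
have asc_sum (f : 'S_n -> V) :
    \sum_(u in young n k | ~~ desc u) f u =
    \sum_(u in young n k | desc u) f (pcomp u (sgen i)).
  rewrite (reindex_inj s_inj); apply: eq_bigl => u.
  by rewrite young_sgenr // /desc -sgen_asc_desc !pcompE sgenL sgenR.
have same (u : 'S_n) : u \in young n k ->
    (u (sposL i) < k)%N = (u (sposR i) < k)%N.
  by move=> /youngP yu; rewrite !yu /=; move: ik; lia.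
(* The values of $u$ at $i$ and $i+1$ lie in one block, where $w$ is increasing, so a descent of $u$
   is one of $wu$. *)
have descw (u : 'S_n) : u \in young n k -> desc u ->
    (pcomp w u (sposR i) < pcomp w u (sposL i))%N.
  by move=> yu du; rewrite !pcompE; apply: incw => //; rewrite same.
rewrite linear_sum scaler_sumr (bigID desc) [RHS](bigID desc) /= !asc_sum.
rewrite -!big_split; apply: eq_bigr => u /andP[yu du] /=.
rewrite !linearZ /= Tbar_Ybas_desc ?descw // Tbar_Ybas_asc; last first.
  by rewrite pcompA !pcompE sgenL sgenR -!pcompE descw.
rewrite !pcompA pcomp_sgenrK (perm_length_sgenr_desc du) exprS.
(* With $l=\ell(us_i)$, the coefficient of $\mathcal Y_{wu}$ is $p^{l+1}(p-q)+p^l\cdot pq=p\cdot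
   p^{l+1}$. *)
rewrite !scalerDr !scalerA -addrA -scalerDl addrC.
by congr (_ *: _ + _ *: _); ring.
Qed.

Lemma Tbarop_block_sum k (w u : 'S_n) :
  block_increasing k w -> u \in young n k ->
  let y := \sum_(v in young n k) p ^+ perm_length v *: Y (pcomp w v) in
  Tbarop p q T u y = p ^+ perm_length u *: y.
Proof.
move=> incw yu /=; set y := \sum_(v in _) _; rewrite /Tbarop.
have [s [rs ws ->]] := op_permP (Tbar p q T) u.
move: rs yu; rewrite -ws; elim: s {ws} => [|i s IHs] ris yis.
  by rewrite perm_length1 expr0 scale1r.
have [rs asc] := reduced_cons ris.
(* If $i+1=k$, the inverse of the whole permutation would have a descent across the block boundary,
   but it preserves the blocks. *)
have ik : i.+1 != k.
  apply/eqP => ik; have /youngP yV := youngV yis.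
  have := yV (sposL i); have := yV (sposR i).
  by rewrite /= !pcomp_sgenlV sgenL sgenR /=; move: asc ik; lia.
have ys : word_perm s \in young n k by move: yis; rewrite /= young_sgenl.
by rewrite /= IHs // linearZ /= Tbar_block_sum // scalerA perm_length_sgenl // exprSr.
Qed.

Variable ev : {linear V -> F^o}.
Hypothesis ev_nz : forall w : 'S_n, ev (Y w) != 0 <-> w = 1%g.

Lemma ev_Ybas (w : 'S_n) : ev (Y w) = if w == 1%g then ev (Y 1%g) else 0.
Proof.
by case: eqP => [->|nw] //; apply/eqP/negbNE/negP => /ev_nz.
Qed.

Lemma ev_Tbarop_Ybas (u w : 'S_n) :
  ev (Tbarop p q T u (Y w)) = if u == w then ev (Y 1%g) else 0.
Proof.
rewrite /Tbarop; have [s [rs <- ->]] := op_permP (Tbar p q T) u.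
elim/last_ind: s w rs => [|s i IHs] w rsi; first by rewrite /= ev_Ybas eq_sym.
have [rs asc] := reduced_rcons rsi.
rewrite /apply_word foldr_rcons -/(apply_word _ _ _) word_perm_rcons.
have E : (pcomp (word_perm s) (sgen i) == w) = (word_perm s == pcomp w (sgen i)).
  by apply/eqP/eqP => [<-|->]; rewrite pcomp_sgenrK.
have lin a v v' : apply_word (Tbar p q T) s (a *: v + v') =
    a *: apply_word (Tbar p q T) s v + apply_word (Tbar p q T) s v'.
  by elim: (s) => //= j r ->; rewrite linearP.
(* The permutation of [s] has an ascent at $i$. If $w$ has one too, it differs from $ws_i$ and both
   sides vanish; if $w$ has a descent, it differs from $w$ and only the term $\mathcal Y_{ws_i}$ can
   contribute. *)
case: (boolP (w (sposL i) < w (sposR i))%N) => [ascw|].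
  rewrite Tbar_Ybas_asc // -[_ *: _]addr0 lin linearD linearZ /= IHs // E.
  case: eqP => [es|_].
    by move: asc; rewrite es !pcompE sgenL sgenR ltnNge (ltnW ascw).
  rewrite scaler0 add0r.
  suff -> : apply_word (Tbar p q T) s 0 = 0 by rewrite linear0.
  by elim: (s) => //= j r ->; rewrite linear0.
rewrite sgen_asc_desc negbK => descw.
rewrite Tbar_Ybas_desc // addrC lin linearD linearZ /= !IHs // E.
case: (word_perm s =P w) => [es|_]; last by rewrite scaler0 add0r.
by move: asc; rewrite es ltnNge (ltnW descw).
Qed.
End HeckeAction.

(** * The homogenised Poincaré polynomial of $S_k\times S_{n-k}$ *)

Section YoungPoincare.
Variables (F : fieldType) (p q : F) (n k : nat).

(** These subgroups grow from the trivial group at $m=0$ to $S_k\times S_{n-k}$ at $m=n$, which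
    allows induction on $m$. *)
Definition young_below (m : nat) : {set 'S_n} :=
  [set w in young n k | [forall a : 'I_n, (m <= a)%N ==> (w a == a)]].

Lemma young_belowP m (w : 'S_n) :
  reflect (w \in young n k /\ forall a : 'I_n, (m <= a)%N -> w a = a)
    (w \in young_below m).
Proof.
rewrite [w \in young_below m]in_set; apply: (iffP andP) => -[yw H]; split=> //.
  by move=> a ma; apply/eqP; move/forallP/(_ a)/implyP: H; apply.
by apply/forallP => a; apply/implyP => /H ->.
Qed.

Lemma young_below_sgenl m (w : 'S_n) (i : 'I_n.-1) :
  i.+1 != k -> (i.+1 < m)%N ->
  (pcomp (sgen i) w \in young_below m) = (w \in young_below m).
Proof.
move=> ik im; have h (u : 'S_n) :
    u \in young_below m -> pcomp (sgen i) u \in young_below m.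
  case/young_belowP=> yu fu; apply/young_belowP; rewrite young_sgenl //; split=> // a ma.
  rewrite pcompE fu //; apply: val_inj => /=; rewrite sgenP.
  by do !case: eqP => //; move: im ma; lia.
by apply/idP/idP => [/h|/h //]; rewrite pcomp_sgenlK.
Qed.

(** For $m\le n$, [young_below m] is a copy of $S_{\min(m,k)}\times S_{m-k}$, with $m-k$ truncated
    at $0$. [D m] is its maximal length, [Q m] its expected Poincaré polynomial, and [lower m] the
    first point of the block of $m$. *)
Let D m := ('C(minn m k, 2) + 'C(m - k, 2))%N.
Let Q m := qfact p q (minn m k) * qfact p q (m - k).
Let lower m := if (m < k)%N then 0%N else k.

Lemma length_bound_recr m : D m.+1 = (D m + (m - lower m))%N.
Proof.
rewrite /D /lower; case: ltnP => km.
  have -> : minn m.+1 k = m.+1 by lia.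
  have [-> ->] : (m.+1 - k)%N = 0%N /\ (m - k)%N = 0%N by lia.
  by rewrite binS bin1; lia.
have -> : minn m.+1 k = k by lia.
by rewrite subSn // binS bin1; lia.
Qed.

Lemma qfactS m : qfact p q m.+1 = qfact p q m * qint p q m.+1.
Proof. by rewrite /qfact big_nat_recr. Qed.

Lemma qfact_young_recr m : Q m.+1 = Q m * qint p q (m - lower m).+1.
Proof.
rewrite /Q /lower; case: ltnP => km.
  have -> : minn m.+1 k = m.+1 by lia.
  have [-> ->] : (m.+1 - k)%N = 0%N /\ (m - k)%N = 0%N by lia.
  by rewrite qfactS subn0 mulrAC.
have -> : minn m.+1 k = k by lia.
by rewrite subSn // qfactS mulrA.
Qed.

Section Step.
Variables (m : nat) (mn : (m < n)%N).
Let om : 'I_n := Ordinal mn.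
Hypothesis lenm : forall w, w \in young_below m -> (perm_length w <= D m)%N.
Hypothesis summ :
  \sum_(w in young_below m) p ^+ perm_length w * q ^+ (D m - perm_length w) = Q m.

(* Left multiplication by s_c identifies the elements sending m to c with
   those sending m to c + 1 and lowers the length by one. *)
Lemma young_below_fiber d c : (c + d)%N = m -> (lower m <= c)%N ->
  (forall w, w \in young_below m.+1 -> nat_of_ord (w om) = c ->
    (perm_length w <= D m + d)%N) /\
  \sum_(w in young_below m.+1 | w om == c :> nat)
    p ^+ perm_length w * q ^+ (D m + d - perm_length w) = p ^+ d * Q m.
Proof.
elim: d c => [|d IHd] c cdm lc.
  (* When $c=m$ the point $m$ is fixed, which leaves exactly [young_below m]. *)
  have E w : (w \in young_below m.+1) && (w om == c :> nat) = (w \in young_below m).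
    apply/andP/young_belowP => [[/young_belowP[yw fw] /eqP wm]|[yw fw]].
      split=> // a; rewrite leq_eqVlt => /orP[/eqP am|/fw //].
      have -> : a = om by apply: val_inj.
      by apply: val_inj; rewrite /= wm -cdm addn0.
    split; last by rewrite fw //= -[X in X == _]cdm addn0.
    by apply/young_belowP; split=> // a ma; apply: fw; apply: ltnW.
  split=> [w yw /eqP wc|]; first by rewrite addn0 lenm // -E yw.
  by rewrite addn0 expr0 mul1r -summ; apply: eq_bigl => w; rewrite E.
have ci : (c < n.-1)%N by move: mn cdm; lia.
pose i := Ordinal ci; have [IHl IHs] := IHd c.+1 (etrans (addSnnS _ _) cdm) (leqW lc).
(* Since [lower m] $\le c<m$, the points $c$ and $c+1$ lie in the block of $m$. *)
have ik : i.+1 != k by move: lc; rewrite /lower /=; case: ltnP; lia.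
have im : (i.+1 < m.+1)%N by rewrite /=; lia.
have sw (w : 'S_n) : (w om == c :> nat) = (pcomp (sgen i) w om == c.+1 :> nat).
  by rewrite pcompE sgenP /=; do !case: eqP; lia.
have len w : w \in young_below m.+1 -> w om == c :> nat ->
    perm_length w = (perm_length (pcomp (sgen i) w)).+1.
  move=> yw wc; apply: perm_length_sgenl_desc; have [_ fw] := young_belowP _ _ yw.
  have iL : w om = sposL i by apply: val_inj; apply/eqP.
  (* Here $w^{-1}(c)=m$. Were $w^{-1}(c+1)\ge m$, it would be $m$ itself, contrary to $w(m)=c$, or a
     fixed point beyond $m$, contrary to $c+1\le m$. *)
  rewrite -[in X in (_ < X)%N]iL permK /= ltnNge; apply/negP => le.
  have [e|] := eqVneq om (w^-1%g (sposR i)).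
    have : w om = sposR i by rewrite -[sposR i](permKV w) -e.
    by rewrite iL => /(congr1 val) /=; lia.
  rewrite -val_eqE /= => ne.
  have : w (w^-1%g (sposR i)) = w^-1%g (sposR i) by apply: fw; move: le ne; lia.
  by rewrite permKV => e; move: le ne; rewrite -e /=; lia.
split=> [w yw /eqP wc|].
  by rewrite len // addnS ltnS IHl ?young_below_sgenl //; apply/eqP; rewrite -sw.
rewrite exprS -mulrA -IHs mulr_sumr.
rewrite [RHS](reindex_inj (can_inj (pcomp_sgenlK i))) /=.
apply: eq_big => [w|w /andP[yw wc]]; first by rewrite young_below_sgenl // sw.
by rewrite len // addnS subSS exprS mulrA.
Qed.

Lemma young_below_range w : w \in young_below m.+1 -> (lower m <= w om <= m)%N.
Proof.
case/young_belowP=> /youngP yw fw; apply/andP; split.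
  rewrite /lower; case: ltnP => // km; have := yw om; rewrite /=; move: km; lia.
rewrite leqNgt; apply/negP => lt; have := fw _ lt => /perm_inj /(congr1 val) /=.
by move: lt; lia.
Qed.

Lemma sum_qint b : (b <= m)%N ->
  \sum_(c < n | (b <= c <= m)%N) q ^+ (c - b) * p ^+ (m - c) = qint p q (m - b).+1.
Proof.
move=> bm; transitivity (\sum_(b <= c < m.+1) q ^+ (c - b) * p ^+ (m - c)).
  by rewrite (big_nat_widen _ _ n) // big_geq_mkord; apply: eq_bigl => c; rewrite andbC.
rewrite big_nat_rev -{1}[b]add0n big_addn big_mkord subSn //.
apply: eq_bigr => j _; rewrite mulrC; have := ltn_ord j.
by move=> jm; congr (_ ^+ _ * _ ^+ _); move: jm bm; lia.
Qed.

(** Split by the image $c$ of $m$: each fiber contributes $q^{c-b}p^{m-c}$ times [Q m], where $b$ is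
    [lower m], and these factors add up to $[m-b+1]$. The length bound is carried along because the
    exponents of $q$ are truncated differences. *)
Lemma young_below_step :
  (forall w, w \in young_below m.+1 -> (perm_length w <= D m.+1)%N) /\
  \sum_(w in young_below m.+1)
    p ^+ perm_length w * q ^+ (D m.+1 - perm_length w) = Q m.+1.
Proof.
have lm : (lower m <= m)%N by rewrite /lower; case: ltnP.
have fib c : (lower m <= c <= m)%N ->
    (c + (m - c))%N = m /\ (lower m <= c)%N by lia.
rewrite length_bound_recr qfact_young_recr; split=> [w yw|].
  have := young_below_range yw; move: (erefl (nat_of_ord (w om))).
  case: {1 3 4}(w om) => c cn /= wc /[dup] cm /fib [e1 e2].
  have [len _] := young_below_fiber e1 e2; have := len w yw (esym wc).
  by move: cm; lia.
rewrite (partition_big (fun w : 'S_n => w om) (fun c => lower m <= c <= m)%N) /=; last first.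
  exact: young_below_range.
rewrite -sum_qint // mulr_sumr; apply: eq_bigr => c cm.
have [e1 e2] := fib _ cm; have [len sum] := young_below_fiber e1 e2.
rewrite mulrCA [Q m * _]mulrC -sum mulr_sumr.
apply: eq_big => [w|w /andP[yw /eqP wc]]; first by rewrite -val_eqE.
rewrite mulrCA -exprD; congr (_ * _ ^+ _).
by have := len w yw (congr1 val wc); move: cm; lia.
Qed.
End Step.

Lemma young_poincare : (k <= n)%N ->
  \sum_(w in young n k)
    p ^+ perm_length w * q ^+ (dlen n k - perm_length w) =
  qfact p q k * qfact p q (n - k).
Proof.
move=> kn.
have all m : (m <= n)%N ->
    (forall w, w \in young_below m -> (perm_length w <= D m)%N) /\
    \sum_(w in young_below m)
      p ^+ perm_length w * q ^+ (D m - perm_length w) = Q m.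
  elim: m => [_|m IHm mn]; last first.
    by have [] := IHm (ltnW mn); apply: young_below_step.
  have E w : (w \in young_below 0) = (w == 1%g).
    apply/young_belowP/eqP => [[_ fw]|->].
      by apply/permP => a; rewrite perm1 fw.
    by split=> [|a _]; [apply/youngP => a|]; rewrite perm1.
  split=> [w|]; first by rewrite E => /eqP ->; rewrite perm_length1.
  under eq_bigl => w do rewrite E.
  rewrite big_pred1_eq perm_length1 /D /Q min0n sub0n subn0 addn0 bin0n !expr0.
  by rewrite /qfact !big_nil !mulr1.
(* At $m=n$ the fixed-point condition is vacuous. *)
have [_] := all n (leqnn n); rewrite /D /Q (minn_idPr kn) => <-.
apply: eq_bigl => w; apply/idP/young_belowP => [yw|[] //].
by split=> // a; rewrite leqNgt ltn_ord.
Qed.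
End YoungPoincare.

(** * Grassmannian permutations *)

Section Grassmannian.
Variables (n k : nat) (kn : (k <= n)%N).
Implicit Types lam mu nu : {ffun 'I_k -> 'I_(n - k).+1}.

Lemma in_boxP lam : @in_box n k lam ->
  forall i j : 'I_k, (i <= j)%N -> (lam j <= lam i)%N.
Proof. by move=> /forallP h i j ij; move/forallP/(_ j)/implyP: (h i); apply. Qed.

Lemma is_wlamP lam (w : 'S_n) : is_wlam lam w ->
  (forall (i : 'I_k) (a : 'I_n), nat_of_ord a = (k - 1 - i)%N ->
     nat_of_ord (w a) = (lam i + (k - 1 - i))%N) /\
  (forall a b : 'I_n, (k <= a)%N -> (a < b)%N -> (w a < w b)%N).
Proof.
case/andP=> /forallP h1 /forallP h2; split=> [i a /eqP ai|a b ka ab].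
  by apply/eqP; move/forallP/(_ a)/implyP: (h1 i); apply.
by move/forallP/(_ b)/implyP: (h2 a); apply; rewrite ka.
Qed.

(** In one-line notation, list the values prescribed on the first $k$ positions, distinct because
    strictly increasing, and then the remaining values in increasing order. *)
Lemma wlam_exists lam : @in_box n k lam -> exists w : 'S_n, is_wlam lam w.
Proof.
move=> /in_boxP box.
have g_lt (j : 'I_k) : (lam (rev_ord j) + j < n)%N.
  by have := ltn_ord (lam (rev_ord j)); have := ltn_ord j; move: kn; lia.
pose g j := Ordinal (g_lt j).
have g_mono (i j : 'I_k) : (i < j)%N -> (g i < g j)%N.
  move=> ij /=; have : (rev_ord j <= rev_ord i)%N by rewrite /=; lia.
  by move=> /box; lia.
have g_inj : injective g.
  move=> i j e; apply: val_inj => /=.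
  by case: (ltngtP i j) => // /g_mono; rewrite e ltnn.
pose s := [seq g j | j <- enum 'I_k].
pose t := [seq a <- enum 'I_n | a \notin s].
have szs : size s = k by rewrite size_map size_enum_ord.
have ust : uniq (s ++ t).
  rewrite cat_uniq map_inj_uniq // enum_uniq filter_uniq ?enum_uniq // andbT.
  by apply/hasPn => a; rewrite mem_filter => /andP[].
have szst : size (s ++ t) = n.
  rewrite -[RHS]size_enum_ord; apply/perm_size/uniq_perm; rewrite ?enum_uniq // => a.
  by rewrite mem_cat mem_filter mem_enum /= andbT orbN.
(* The default of [nth] is the argument itself since ['I_n] may be empty; it is never reached, as
   the list has length $n$. *)
have f_inj : injective (fun a : 'I_n => nth a (s ++ t) a).
  move=> a b; rewrite (set_nth_default a b) ?szst // => /eqP.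
  by rewrite nth_uniq ?szst // => /eqP /val_inj.
have srt : sorted (fun a b : 'I_n => (a < b)%N) t.
  apply: sorted_filter; first by move=> ? ? ?; apply: ltn_trans.
  by rewrite -(@sorted_map _ _ val ltn) val_enum_ord iota_ltn_sorted.
exists (perm f_inj); apply/andP; split; apply/forallP.
  move=> i; apply/forallP => a; apply/implyP => /eqP ai; rewrite permE.
  have ak : (a < k)%N by rewrite [nat_of_ord a]ai; have := ltn_ord i; lia.
  rewrite nth_cat szs ak (nth_map i) ?size_enum_ord //=.
  set j := nth i _ _; have jE : nat_of_ord j = a by rewrite /j nth_enum_ord.
  have -> : rev_ord j = i.
    by apply: val_inj; rewrite /= jE [nat_of_ord a]ai; have := ltn_ord i; lia.
  by rewrite jE [nat_of_ord a]ai.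
move=> a; apply/forallP => b; apply/implyP => /andP[ka ab]; rewrite !permE.
have kb := leq_trans ka (ltnW ab).
have szt : size t = (n - k)%N.
  by apply: (@addnI k); rewrite subnKC // -[X in (X + _)%N = _]szs -size_cat.
have lta := ltn_ord a; have ltb := ltn_ord b.
rewrite !nth_cat szs !(ltnNge _ k) ka kb /= (set_nth_default a b); last by rewrite szt; lia.
have tr : transitive (fun a b : 'I_n => (a < b)%N) by move=> ? ? ?; apply: ltn_trans.
by apply: (sorted_ltn_nth tr a srt); rewrite ?inE ?szt; lia.
Qed.

(** Existence excludes the default value $1$ in [wlam]. *)
Lemma wlamP lam : @in_box n k lam -> is_wlam lam (wlam lam).
Proof.
move=> /wlam_exists [w wP]; rewrite /wlam.
by case: pickP => //= /(_ w); rewrite wP.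
Qed.

(** On the first block, position $a$ carries the part of index $k-1-a$; the parts weakly grow with
    $a$, so adding $a$ makes the values strictly increase. *)
Lemma wlam_block_increasing lam : @in_box n k lam -> block_increasing k (wlam lam).
Proof.
move=> box a b abk ab; have [wE winc] := is_wlamP (wlamP box).
case: (leqP k a) abk => [ka _|ak /esym bk]; first exact: winc.
have rk (c : 'I_n) : (c < k)%N -> (k - 1 - c < k)%N by lia.
have ra := wE (Ordinal (rk a ak)) a; have rb := wE (Ordinal (rk b bk)) b.
rewrite ra ?rb /=; try lia.
have : (lam (Ordinal (rk a ak)) <= lam (Ordinal (rk b bk)))%N.
  by apply: (in_boxP box) => /=; lia.
lia.
Qed.

Lemma wlam_inj mu nu : @in_box n k mu -> @in_box n k nu -> wlam mu = wlam nu -> mu = nu.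
Proof.
move=> bmu bnu e; have [mE _] := is_wlamP (wlamP bmu).
have [nE _] := is_wlamP (wlamP bnu); apply/ffunP => i; apply: val_inj => /=.
have lt : (k - 1 - i < n)%N by have := ltn_ord i; move: kn; lia.
have := mE i (Ordinal lt) erefl; rewrite e (nE i (Ordinal lt) erefl); lia.
Qed.

(* The w_lambda are the minimal-length representatives of the cosets of
   S_k x S_(n-k). *)
Lemma wlam_coset mu nu (u : 'S_n) : @in_box n k mu -> @in_box n k nu ->
  u \in young n k -> (wlam mu == pcomp (wlam nu) u) = (mu == nu) && (u == 1%g).
Proof.
move=> bmu bnu /youngP yu; apply/eqP/andP => [e|[/eqP -> /eqP ->]]; last first.
  by rewrite /Defs.pcomp mul1g.
(* A descent of $u$ inside a block would be one of $w_\nu u=w_\mu$, which is increasing there; a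
   descent across the boundary is impossible since $u$ preserves the blocks. *)
have u1 : u = 1%g.
  apply: perm_no_descent => i; rewrite sgen_asc_desc; apply/negP => desc.
  have [ik|ik] := eqVneq i.+1 k.
    by have := yu (sposL i); have := yu (sposR i); rewrite /=; move: desc; lia.
  have same : (sposL i < k)%N = (sposR i < k)%N by rewrite /=; lia.
  have := wlam_block_increasing bmu same (ltnSn _).
  rewrite e !pcompE ltnNge ltnW //.
  by apply: (wlam_block_increasing bnu) => //; rewrite !yu same.
move: e; rewrite u1 /Defs.pcomp mul1g => /(wlam_inj bmu bnu) ->.
by rewrite !eqxx.
Qed.
End Grassmannian.

(** * Duality and the expansion formula *)

Section Duality.
Variables (F : fieldType) (V : lmodType F) (n k : nat) (p q : F).
Variable T : 'I_n.-1 -> {linear V -> V}.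
Hypothesis quad : forall i v,
  T i (T i v - q *: v) + p *: (T i v - q *: v) = 0.
Hypothesis braid : forall (i j : 'I_n.-1) v, val j = (val i).+1 ->
  T i (T j (T i v)) = T j (T i (T j v)).
Hypothesis comm : forall (i j : 'I_n.-1) v, (i.+1 < j)%N ->
  T i (T j v) = T j (T i v).
Variables (Yw0 : V) (ev : {linear V -> F^o}).
Hypothesis ev_nz : forall w : 'S_n, ev (Ybas T Yw0 w) != 0 <-> w = 1%g.
Hypotheses (kn : (k <= n)%N) (qnz : qfact p q k * qfact p q (n - k) != 0).
Implicit Types mu nu : {ffun 'I_k -> 'I_(n - k).+1}.

Lemma Sigma_Ylam nu : @in_box n k nu ->
  Sigma p q T k (Ylam p T Yw0 nu) = Ylam p T Yw0 nu.
Proof.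
move=> bnu; have inc := wlam_block_increasing kn bnu; rewrite /Sigma.
(* The eigenvalue $p^{\ell(u)}$ and the weight $q^{d-\ell(u)}$ combine to the summand of
   [young_poincare]. *)
under eq_bigr => u yu do rewrite /Ylam (Tbarop_block_sum quad braid comm) // scalerA mulrC.
by rewrite -scaler_suml young_poincare // scalerA mulVf ?scale1r.
Qed.

Lemma ev_Tbarlam_Ylam mu nu : @in_box n k mu -> @in_box n k nu ->
  ev (Tbarlam p q T mu (Ylam p T Yw0 nu)) =
  if mu == nu then ev (Ybas T Yw0 1%g) else 0.
Proof.
move=> bmu bnu; rewrite /Tbarlam Sigma_Ylam // /Ylam !linear_sum /=.
have y1 : 1%g \in young n k by apply/youngP => a; rewrite perm1.
(* By [wlam_coset] only $u=1$ can contribute, with weight $p^0=1$. *)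
rewrite (bigD1 1%g) //= big1 => [|u /andP[yu u1]]; last first.
  rewrite !linearZ /= (ev_Tbarop_Ybas quad braid comm ev_nz) wlam_coset //.
  by rewrite (negPf u1) andbF scaler0.
rewrite !linearZ /= (ev_Tbarop_Ybas quad braid comm ev_nz) wlam_coset //.
by rewrite eqxx andbT perm_length1 expr0 scale1r addr0.
Qed.
End Duality.

Theorem theorem4p10
  (F : fieldType) (V : vectType F) (n k : nat)
  (p q hb : F) (t : 'I_n -> F)
  (T : 'I_n.-1 -> {linear V -> V}) (x : 'I_n -> {linear V -> V})
  (Yw0 : V) (ev : {linear V -> F^o}) :
  (* F receives a ring map from Q[p, q, hbar]: characteristic zero *)
  [pchar F] =i pred0 ->
  (* V is an \hat H_n-module *)
  affine_hecke_relations p q hb T x ->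
  (* the Y_w = T_{w^-1 w_0} Y_{w_0} form a basis of V *)
  basis_of fullv [seq Ybas T Yw0 w | w : 'S_n] ->
  (* the evaluation map *)
  (forall w : 'S_n, ev (Ybas T Yw0 w) != 0 <-> w = 1%g) ->
  (forall (i : 'I_n) (w : 'S_n),
     ev (x i (Ybas T Yw0 w)) = t i * ev (Ybas T Yw0 w)) ->
  (k <= n)%N ->
  qfact p q k * qfact p q (n - k) != 0 ->
  (forall mu nu : {ffun 'I_k -> 'I_(n - k).+1}, @in_box n k mu -> @in_box n k nu ->
     ev (Tbarlam p q T mu (Ylam p T Yw0 nu))
     = if mu == nu then ev (Ybas T Yw0 1%g) else 0)
  /\
  (forall f : V,
     (exists c : {ffun 'I_k -> 'I_(n - k).+1} -> F,
        f = \sum_(lam : {ffun 'I_k -> 'I_(n - k).+1} | @in_box n k lam) c lam *: Ylam p T Yw0 lam) ->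
     f = (ev (Ybas T Yw0 1%g))^-1 *:
           \sum_(lam : {ffun 'I_k -> 'I_(n - k).+1} | @in_box n k lam) ev (Tbarlam p q T lam f) *: Ylam p T Yw0 lam).
Proof.
move=> _ [quad [braid [comm _]]] _ ev_nz _ kn qnz.
have dual mu nu := ev_Tbarlam_Ylam quad braid comm ev_nz kn qnz (mu := mu) (nu := nu).
split=> // f [c ->]; have nz : ev (Ybas T Yw0 1%g) != 0 by apply/ev_nz.
(* The two sums are compared term by term: applying the dual operator of $\mu$ extracts the
   coefficient [c mu], up to the nonzero factor $\operatorname{ev}(\mathcal Y_{\mathrm{id}})$. *)
rewrite scaler_sumr; apply: eq_bigr => mu bmu; rewrite scalerA.
suff -> : ev (Tbarlam p q T mu (\sum_(nu | @in_box n k nu) c nu *: Ylam p T Yw0 nu)) =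
    c mu * ev (Ybas T Yw0 1%g) by rewrite mulrCA mulVf // mulr1.
rewrite !linear_sum (bigD1 mu) //= big1 => [|nu /andP[bnu ne]].
  by rewrite !linearZ /= dual // eqxx addr0.
by rewrite !linearZ /= dual // eq_sym (negPf ne) scaler0.
Qed.
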